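(* Let $\xi_1,\ldots,\xi_n$ be independent nonnegative random variables with finite moments $m_{i,k}=\mathbf{E}[\xi_i^k]$, $i=1,\ldots,n$, $k=1,2,\ldots$. Suppose that the growth rates $r_1,\ldots,r_n$ of the moments satisfy $$\frac{m_{1,k+1}}{m_{1,k}}=\mathcal{O}((k+1)^{r_1}),\ \ldots,\ \frac{m_{n,k+1}}{m_{n,k}}=\mathcal{O}((k+1)^{r_n})\quad\text{as } k\to\infty.$$ If the rates $r_1,\ldots,r_n$ are such that $r_1+\cdots+r_n\le 2$, then the product $Z_n=\xi_1\cdots\xi_n$ is M-det.
   Context: A random variable $X$ with distribution function $F$ and moments $m_k=\mathbf{E}[X^k]$ (all finite) is called moment determinate (M-det) if $F$ is the only distribution having the moment sequence $\{m_k\}_{k=1}^\infty$. *)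

(* Defs.v *)
From HB Require Import structures.
From mathcomp Require Import all_boot all_order all_algebra.
From mathcomp Require Import all_classical all_reals all_analysis.
Set Implicit Arguments.
Unset Strict Implicit.
Unset Printing Implicit Defensive.
Import Order.TTheory GRing.Theory Num.Theory.
Import numFieldNormedType.Exports.
Local Open Scope classical_set_scope.
Local Open Scope ring_scope.

(* Mutual independence of a finite family; taking some A i := setT gives the
   product rule for every subfamily. *)
Definition independent_RVs (R : realType) (d d' : measure_display)
    (T : measurableType d) (T' : measurableType d') (P : probability T R)
    (n : nat) (X : 'I_n -> {RV P >-> T'}) : Prop :=
  forall A : 'I_n -> set T', (forall i, measurable (A i)) ->
    P (\bigcap_(i in [set: 'I_n]) (X i @^-1` A i)) =
    (\prod_(i < n) P (X i @^-1` A i))%E.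

Definition finite_moments (R : realType) (d : measure_display)
    (T : measurableType d) (P : probability T R) (X : {RV P >-> R}) : Prop :=
  forall k : nat, P.-integrable [set: T] (fun w => (X w ^+ k)%:E).

Definition moment (R : realType) (d : measure_display)
    (T : measurableType d) (P : probability T R) (X : {RV P >-> R})
    (k : nat) : \bar R :=
  'E_P[fun w => X w ^+ k].

Arguments finite_moments {R d T} P X.
Arguments moment {R d T} P X k.

Section RV_prod.
Context (R : realType) (d : measure_display) (T : measurableType d)
  (P : probability T R) (n : nat) (X : 'I_n -> {RV P >-> R}).

Definition RV_prod : T -> R := fun w => \prod_(i < n) X i w.

Let measurable_RV_prod : measurable_fun [set: T] RV_prod.
Proof. by apply: measurable_prod => i _; exact: measurable_funPT. Qed.

HB.instance Definition _ :=
  isMeasurableFun.Build _ _ _ _ RV_prod measurable_RV_prod.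

End RV_prod.

(* Competing laws range over all Borel probability measures on the whole real
   line (Hamburger sense), even when X is nonnegative. *)
Definition moment_determinate (R : realType) (d : measure_display)
    (T : measurableType d) (P : probability T R) (X : {RV P >-> R}) : Prop :=
  finite_moments P X /\
  forall Q : probability R R,
    (forall k : nat, (0 < k)%N ->
       Q.-integrable [set: R] (fun x => (x ^+ k)%:E) /\
       (\int[Q]_x (x ^+ k)%:E)%E = moment P X k) ->
    forall B : set R, measurable B -> Q B = distribution P X B.
Arguments moment_determinate {R d T} P X.

(* Main.v *)
Require Import Defs.
From HB Require Import structures.
From mathcomp Require Import all_boot all_order all_algebra.
From mathcomp Require Import all_classical all_reals all_analysis.
From mathcomp Require Import measurable_realfun random_variable.
From mathcomp Require Import ring lra.
Set Implicit Arguments.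
Unset Strict Implicit.
Unset Printing Implicit Defensive.
Import Order.TTheory GRing.Theory Num.Theory.
Import numFieldNormedType.Exports.
Local Open Scope classical_set_scope.
Local Open Scope ring_scope.

(** Write Z for the product.  By independence the moments of Z are the products
    of the moments of the factors, so the growth rates add up and
    E[Z^(k+1)] = O((k+1)^2 E[Z^k]); hence E[Z^k] <= M C^k (k!)^2 for all k
    ([independent_prod_le], [le_fact_sqr_of_ratio]).  It remains to see that such
    a bound determines a law nu carried by the half-line, even among laws mu on
    the whole real line ([eq_probability_moments]).

    Consider the entire function of x that is cos (t sqrt x) for x >= 0 and
    cosh (t sqrt (- x)) for x < 0 ([cosroot]).  Its power series has coefficients
    of size t^(2l) / (2l)!, and under both laws the absolute moment of
    order l is O(C^l (2l)!) ([abs_moment_bounded]), so for small t it can be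
    integrated term by term: mu and nu give it the same integral.  The identity
    cos (a + h) + cos (a - h) = 2 cos a cos h propagates this to all t, with a step
    h that depends on C only ([agree_mul_cosroot]).  The one obstacle is that the
    function is unbounded on the negative half-line, where mu may have mass.
    There, however, it is positive, so that its absolute moments over the negatives
    are controlled by signed ones, which are already known to be those of nu
    ([le_abs_cosroot]).

    Now the integrals of cosh (t sqrt (- x)) over the negatives stay bounded as t
    grows, which forces mu to be carried by the half-line as well.  Thus mu and nu
    have the same cosine transform in the variable sqrt x.  Powers of cosines are
    combinations of cosines, and cos (b / m) ^ (m^2) tends to exp (- b^2 / 2), so mu
    and nu have the same Laplace transform; polynomials in exp (- s x) converge
    boundedly to indicators of tails ([threshold]), and the tails determine the
    law. *)

(** * Functions with the same integral under two laws *)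

Section agree.
Context d (T : measurableType d) (R : realType) (mu nu : probability T R).
Implicit Types f g : T -> R.

Definition agree g : Prop :=
  [/\ mu.-integrable setT (EFin \o g), nu.-integrable setT (EFin \o g) &
      (\int[mu]_x (g x)%:E = \int[nu]_x (g x)%:E)%E].

Lemma eq_agree f g : f =1 g -> agree f -> agree g.
Proof. by move=> /funext ->. Qed.

Lemma agreeZ (a : R) f : agree f -> agree (fun x => a * f x).
Proof.
move=> [i1 i2 e]; split.
- exact: (integrableZl measurableT a i1).
- exact: (integrableZl measurableT a i2).
- under eq_integral do rewrite EFinM.
  under [RHS]eq_integral do rewrite EFinM.
  by rewrite (integralZl measurableT i1) (integralZl measurableT i2) /= e.
Qed.

Lemma agreeD f g : agree f -> agree g -> agree (fun x => f x + g x).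
Proof.
move=> [f1 f2 ef] [g1 g2 eg]; split.
- exact: (integrableD measurableT f1 g1).
- exact: (integrableD measurableT f2 g2).
- by rewrite (integralD_EFin measurableT f1 g1) (integralD_EFin measurableT f2 g2)
             /= ef eg.
Qed.

Lemma agree0 : agree (fun _ => 0).
Proof.
split; [exact: integrable0 | exact: integrable0 | by rewrite !integral0].
Qed.

Lemma agree_sum n (f : nat -> T -> R) : (forall i, agree (f i)) ->
  agree (fun x => \sum_(0 <= i < n) f i x).
Proof.
move=> fi; elim: n => [|n IH].
  by apply: eq_agree agree0 => x; rewrite big_geq.
apply: eq_agree (agreeD IH (fi n)) => x.
by rewrite big_nat_recr.
Qed.

(** Dominated convergence, under both laws at once.  The dominating function takes
    extended values so that it can be the sum of a series of nonnegative functions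
    whose pointwise convergence need not be discussed. *)
Lemma agree_cvg (f : nat -> T -> R) g (G : T -> \bar R) :
  (forall n, agree (f n)) -> (forall x, f ^~ x @ \oo --> g x) ->
  mu.-integrable setT G -> nu.-integrable setT G ->
  (forall n x, (`|f n x|%:E <= G x)%E) -> agree g.
Proof.
move=> fa fg G1 G2 fG.
have mf n : measurable_fun setT (f n).
  by case: (fa n) => i _ _; apply/measurable_EFinP; exact: (measurable_int mu).
have mg : measurable_fun setT g.
  by apply: (measurable_fun_cvg mf) => x _; exact: fg.
have fgE x : setT x -> (fun n => (f n x)%:E) @ \oo --> (g x)%:E.
  by move=> _; apply: cvg_EFin; [exact: nearW | exact: fg].
have D (m : probability T R) : m.-integrable setT G ->
    m.-integrable setT (EFin \o g) /\
    (fun n => \int[m]_x (f n x)%:E)%E @ \oo --> (\int[m]_x (g x)%:E)%E.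
  move=> iG; have [] := @dominated_convergence _ _ _ m setT measurableT
      (fun n => EFin \o f n) (EFin \o g) G.
  - by move=> n; exact/measurable_EFinP.
  - exact/measurable_EFinP.
  - by apply: aeW => x; exact: fgE.
  - by [].
  - by apply: aeW => x n _; exact: fG.
  - by move=> ? _ ?; split.
have [h1 c1] := D mu G1; have [h2 c2] := D nu G2.
split=> //; rewrite -(cvg_lim _ c1)// -(cvg_lim _ c2)//.
by congr (lim (_ @ \oo)); apply/funext => n; case: (fa n).
Qed.

Lemma agree_bounded_cvg (f : nat -> T -> R) g (M : R) :
  (forall n, agree (f n)) -> (forall x, f ^~ x @ \oo --> g x) ->
  (forall n x, `|f n x| <= M) -> agree g.
Proof.
move=> fa fg fM.
apply: (agree_cvg (G := EFin \o cst M) fa fg) => [||n x].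
- exact: finite_measure_integrable_cst.
- exact: finite_measure_integrable_cst.
- by rewrite lee_fin.
Qed.

End agree.

(** * The entire function cos (t sqrt x) *)

Section cosroot.
Context (R : realType).
Implicit Types t h x : R.

Definition cosh (z : R) : R := (expR z + expR (- z)) / 2.

(** The value at x of the entire function whose power series is the sum of the
    (-1)^l (t^2 x)^l / (2l)!, see [cvg_cosroot_series]. *)
Definition cosroot t x : R :=
  if 0 <= x then cos (t * Num.sqrt x) else cosh (t * Num.sqrt (- x)).

Lemma cosroot0 x : cosroot 0 x = 1.
Proof.
by rewrite /cosroot /cosh !mul0r cos0 oppr0 expR0; case: ifP => // _; lra.
Qed.

Lemma cosrootDB t h x :
  cosroot (t + h) x + cosroot (t - h) x = 2 * (cosroot t x * cosroot h x).
Proof.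
rewrite /cosroot; case: ifP => _; rewrite !(mulrDl, mulNr).
  by rewrite !cosD sinN cosN; ring.
by rewrite /cosh !opprD !opprK !expRD; field.
Qed.

Lemma normr_cosroot_le1 t x : 0 <= x -> `|cosroot t x| <= 1.
Proof. by rewrite /cosroot => ->; exact: cos_max. Qed.

(** This quadratic growth in t on the negatives is what excludes mass there: the
    constant 1/4 comes from keeping only exp z >= z^2 / 2 in cosh z. *)
Lemma cosroot_lt0_ge t x : 0 <= t -> x < 0 -> t ^+ 2 * `|x| / 4 <= cosroot t x.
Proof.
move=> t0 x0; rewrite /cosroot (lt_geF x0) /cosh.
set z := t * _.
have z0 : 0 <= z by rewrite mulr_ge0// sqrtr_ge0.
have e1 := expR_ge1Dxn 1 z0.
have e2 := expR_ge0 (- z).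
have -> : t ^+ 2 * `|x| = z ^+ 2.
  by rewrite /z exprMn sqr_sqrtr ?oppr_ge0 ?ltW// ltr0_norm.
have -> : z ^+ 2 / 4 = (z ^+ 2 / 2) / 2 by field.
have f2 : 2`!%:R = 2 :> R by [].
rewrite ler_pM2r//; move: e1; rewrite f2; lra.
Qed.

Lemma cosroot_lt0_gt0 t x : x < 0 -> 0 < cosroot t x.
Proof.
move=> x0; rewrite /cosroot (lt_geF x0) /cosh.
by rewrite divr_gt0// addr_gt0// expR_gt0.
Qed.

Lemma measurable_cosroot t : measurable_fun setT (cosroot t).
Proof.
have ms : measurable_fun setT (@Num.sqrt R).
  by apply: continuous_measurable_fun; exact: sqrt_continuous.
apply: measurable_fun_ifT.
- exact: measurable_fun_ler.
- apply: measurableT_comp; last exact: measurable_funM.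
  by apply: continuous_measurable_fun; exact: continuous_cos.
- have mc : measurable_fun setT cosh.
    rewrite /cosh; apply: measurable_funM => //; apply: measurable_funD.
      exact: measurable_expR.
    by apply: (measurableT_comp (@measurable_expR R)); exact: measurable_funN.
  apply: (measurableT_comp mc); apply: measurable_funM => //.
  by apply: (measurableT_comp ms); exact: measurable_funN.
Qed.

Definition cosroot_coeff h (l : nat) : R := (-1) ^+ l * h ^+ l.*2 / (l.*2)`!%:R.

(** The odd terms of the exponential series at z and at - z cancel. *)
Lemma cvg_cosh_series (z : R) :
  series (fun l => z ^+ l.*2 / (l.*2)`!%:R) @ \oo --> cosh z.
Proof.
have E (y : R) : series (exp_coeff y) @ \oo --> expR y.
  exact: is_cvg_series_exp_coeff.
have dbl : (fun n : nat => n.*2) @ \oo --> \oo.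
  apply/cvgnyPge => A; near=> n; rewrite -addnn (leq_trans _ (leq_addr _ _))//.
  by near: n; exact: nbhs_infty_ge.
have H (y : R) : (fun n => series (exp_coeff y) n.*2) @ \oo --> expR y.
  by apply: cvg_comp; [exact: dbl | exact: E].
have -> : series (fun l => z ^+ l.*2 / (l.*2)`!%:R) =
    fun n => (series (exp_coeff z) n.*2 + series (exp_coeff (- z)) n.*2) * 2^-1.
  apply/funext => n; rewrite /series /=.
  elim: n => [|m IH]; first by rewrite !big_geq// addr0 mul0r.
  rewrite doubleS !big_nat_recr//= {}IH /exp_coeff /=.
  rewrite (exprS (- z)) (exprNn z) -signr_odd odd_double expr0 exprS.
  by rewrite !mulrA; lra.
rewrite /cosh; apply: cvgM; last exact: cvg_cst.
by apply: cvgD; exact: H.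
Unshelve. all: end_near. Qed.

Lemma cvg_cosroot_series h x :
  series (fun l => cosroot_coeff h l * x ^+ l) @ \oo --> cosroot h x.
Proof.
rewrite /cosroot; case: leP => x0.
  have := @cvg_cos_coeff' R (h * Num.sqrt x).
  apply: cvg_trans; apply: near_eq_cvg; near=> n.
  apply: eq_bigr => l _; rewrite /cos_coeff' /cosroot_coeff -exprnP exprMn.
  by rewrite -[in x ^+ l](sqr_sqrtr x0) -exprM mul2n; ring.
have := @cvg_cosh_series (h * Num.sqrt (- x)).
apply: cvg_trans; apply: near_eq_cvg; near=> n.
apply: eq_bigr => l _; rewrite /cosroot_coeff exprMn.
have -> : x ^+ l = (-1) ^+ l * Num.sqrt (- x) ^+ l.*2.
  rewrite -mul2n exprM sqr_sqrtr ?oppr_ge0; last exact: ltW.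
  by rewrite -exprMn mulN1r opprK.
have : ((-1) ^+ l * (-1) ^+ l = 1 :> R) by rewrite -expr2 sqrr_sign.
set e := (-1) ^+ l; move=> ee.
by rewrite -[LHS]mul1r -ee; ring.
Unshelve. all: end_near. Qed.

End cosroot.

(** * Termwise integration of cos (h sqrt x) *)

(** The central step behind a radius of convergence that does not depend on k: the
    binomial coefficient of 2(k + l) over 2k is one term in the expansion of
    (1 + 1)^(2(k + l)). *)
Lemma leq_fact_doubleD (k l : nat) :
  ((k + l).*2`! <= 4 ^ (k + l) * ((k.*2)`! * (l.*2)`!))%N.
Proof.
have le2 : ('C((k + l).*2, k.*2) <= 4 ^ (k + l))%N.
  rewrite -[4%N]/(2 ^ 2)%N -expnM mul2n -[X in (_ <= X ^ _)%N](addn1 1).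
  have kl : (k.*2 < (k + l).*2.+1)%N by rewrite ltnS leq_double leq_addr.
  rewrite expnDn (bigD1 (Ordinal kl))//= !exp1n !muln1; exact: leq_addr.
rewrite -(@bin_fact (k + l).*2 k.*2) ?leq_double ?leq_addr//.
rewrite [X in (X - _)%N]doubleD addKn; exact: leq_mul.
Qed.

Section dominator.
Context (R : realType).
Implicit Types (mu nu : probability R R) (w : R -> R).

Lemma measurable_absX_mul w l : measurable_fun setT w ->
  measurable_fun setT (fun x : R => (`|x| ^+ l * `|w x|)%:E).
Proof.
move=> mw; apply/measurable_EFinP; apply: measurable_funM.
  by apply: measurable_funX; exact: normr_measurable.
exact: measurableT_comp.
Qed.

(** The growth (2l)! is that of the denominators in the series of cos (h sqrt x),
    so it leaves a positive radius of convergence in h. *)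
Definition moment_bounded mu w (B C : R) : Prop :=
  forall l : nat,
    (\int[mu]_x (`|x| ^+ l * `|w x|)%:E <= (B * (C ^+ l * (l.*2)`!%:R))%:E)%E.

(** The series of [x ^+ k * (w x * cosroot h x)] with every term replaced by its
    absolute value. *)
Definition dominator w (h : R) (k : nat) (x : R) : \bar R :=
  (\sum_(l <oo) (h ^+ l.*2 / (l.*2)`!%:R * (`|x| ^+ (k + l) * `|w x|))%:E)%E.

Lemma dominator_term_ge0 w h k l x :
  0 <= h ^+ l.*2 / (l.*2)`!%:R * (`|x| ^+ (k + l) * `|w x|).
Proof.
apply: mulr_ge0; last by rewrite mulr_ge0// exprn_ge0.
by rewrite divr_ge0 ?ler0n// -mul2n exprM exprn_ge0// sqr_ge0.
Qed.

(** With 4 h^2 C <= 1/2, the integrated terms of [dominator] are below those of a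
    geometric series of ratio 1/2. *)
Lemma le_dominator_coeff (B C h : R) (k l : nat) :
    0 <= B -> 0 <= C -> 8 * h ^+ 2 * C <= 1 ->
  h ^+ l.*2 / (l.*2)`!%:R * (B * (C ^+ (k + l) * (k + l).*2`!%:R)) <=
  (2 * (B * C ^+ k * (4 ^+ k * (k.*2)`!%:R))) / (2 ^ (l + 1))%:R.
Proof.
move=> B0 C0 hC.
have f0 : 0 < (l.*2)`!%:R :> R by rewrite ltr0n fact_gt0.
have H : (k + l).*2`!%:R <= 4 ^+ (k + l) * ((k.*2)`!%:R * (l.*2)`!%:R) :> R.
  by rewrite -natrX -!natrM ler_nat; exact: leq_fact_doubleD.
have h0 : 0 <= h ^+ l.*2 by rewrite -mul2n exprM exprn_ge0// sqr_ge0.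
apply: (@le_trans _ _ (h ^+ l.*2 / (l.*2)`!%:R * (B * (C ^+ (k + l) *
    (4 ^+ (k + l) * ((k.*2)`!%:R * (l.*2)`!%:R)))))).
  apply: ler_wpM2l; first by rewrite divr_ge0// ltW.
  by apply: ler_wpM2l => //; apply: ler_wpM2l => //; rewrite exprn_ge0.
have D0 : 0 <= B * C ^+ k * (4 ^+ k * (k.*2)`!%:R).
  by rewrite !mulr_ge0 ?exprn_ge0// ltW.
rewrite [leLHS](_ : _ = (B * C ^+ k * (4 ^+ k * (k.*2)`!%:R)) * (4 * h ^+ 2 * C) ^+ l);
  last first.
  rewrite !exprD exprMn (exprMn _ 4) -mul2n exprM; field.
  by rewrite gt_eqF.
rewrite [leRHS](_ : _ = (B * C ^+ k * (4 ^+ k * (k.*2)`!%:R)) * (2^-1) ^+ l);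
  last first.
  by rewrite addn1 natrX exprS exprVn; field; rewrite expf_neq0.
apply: ler_wpM2l => //; apply: lerXn2r; rewrite ?nnegrE//.
  by rewrite mulr_ge0// mulr_ge0// sqr_ge0.
lra.
Qed.

Lemma dominator_integrable mu w (B C h : R) (k : nat) :
    measurable_fun setT w -> 0 <= B -> 0 <= C -> 8 * h ^+ 2 * C <= 1 ->
    moment_bounded mu w B C ->
  mu.-integrable setT (dominator w h k).
Proof.
move=> mw B0 C0 hC bw.
have mt l : measurable_fun setT
    (fun x : R => (h ^+ l.*2 / (l.*2)`!%:R * (`|x| ^+ (k + l) * `|w x|))%:E).
  apply/measurable_EFinP; apply: measurable_funM => //.
  by have /measurable_EFinP := measurable_absX_mul (k + l) mw.
have G0 x : (0 <= dominator w h k x)%E.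
  by apply: nneseries_ge0 => l _ _; rewrite lee_fin dominator_term_ge0.
apply/integrableP; split.
  apply: ge0_emeasurable_sum => // l x _ _.
  by rewrite lee_fin dominator_term_ge0.
under eq_integral do rewrite gee0_abs//.
rewrite integral_nneseries//; last first.
  by move=> l x _; rewrite lee_fin dominator_term_ge0.
pose D := 2 * (B * C ^+ k * (4 ^+ k * (k.*2)`!%:R)).
apply: (@le_lt_trans _ _ (\sum_(l <oo) (D / (2 ^ (l + 1))%:R)%:E)%E).
  apply: lee_nneseries => [l _ _|l _].
    by apply: integral_ge0 => x _; rewrite lee_fin dominator_term_ge0.
  under eq_integral do rewrite EFinM.
  rewrite ge0_integralZl_EFin//.
  - apply: (le_trans (lee_wpmul2l _ (bw (k + l)%N))).
      rewrite lee_fin divr_ge0 ?ler0n//.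
      by rewrite -mul2n exprM exprn_ge0// sqr_ge0.
    by rewrite -EFinM lee_fin le_dominator_coeff.
  - exact: measurable_absX_mul.
  - by rewrite divr_ge0 ?ler0n// -mul2n exprM exprn_ge0// sqr_ge0.
have := @cvg_geometric_eseries_half R D 0.
by move=> /cvg_lim -> //; rewrite ltry.
Qed.

(** The partial sums of the series are combinations of the functions
    [x ^+ (k + l) * w x], and [dominator] allows the passage to the limit. *)
Lemma agree_mul_cosroot mu nu w (B C h : R) :
    measurable_fun setT w -> 0 <= B -> 0 <= C -> 8 * h ^+ 2 * C <= 1 ->
    moment_bounded mu w B C -> moment_bounded nu w B C ->
    (forall k, agree mu nu (fun x => x ^+ k * w x)) ->
  forall k, agree mu nu (fun x => x ^+ k * (w x * cosroot h x)).
Proof.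
move=> mw B0 C0 hC bm bn aw k.
apply: (@agree_cvg _ _ _ mu nu
  (fun N x => \sum_(0 <= l < N) cosroot_coeff h l * (x ^+ (k + l) * w x)) _
  (dominator w h k)).
- by move=> N; apply: agree_sum => l; exact: agreeZ.
- move=> x; rewrite mulrA.
  have -> : (fun N => \sum_(0 <= l < N) cosroot_coeff h l * (x ^+ (k + l) * w x)) =
      fun N => (x ^+ k * w x) * series (fun l => cosroot_coeff h l * x ^+ l) N.
    apply/funext => N; rewrite /series /= big_distrr /=.
    by apply: eq_bigr => l _; rewrite exprD; ring.
  by apply: cvgM; [exact: cvg_cst | exact: cvg_cosroot_series].
- exact: (dominator_integrable k mw B0 C0 hC bm).
- exact: (dominator_integrable k mw B0 C0 hC bn).
- move=> N x.
  apply: (@le_trans _ _ (\sum_(0 <= l < N)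
     (h ^+ l.*2 / (l.*2)`!%:R * (`|x| ^+ (k + l) * `|w x|))%:E)%E); last first.
    by apply: nneseries_lim_ge => l _ _; rewrite lee_fin dominator_term_ge0.
  rewrite sumEFin lee_fin; apply: (le_trans (ler_norm_sum _ _ _)).
  apply: ler_sum => l _; rewrite /cosroot_coeff.
  rewrite !normrM !normrX normrN1 expr1n mul1r normfV normr_nat.
  by rewrite -mul2n !exprM real_normK ?num_real.
Qed.

End dominator.

(** * Elementary limits *)

Section real_limits.
Context (R : realType).
Implicit Types (a b u v w : R) (n m : nat).

Lemma exprB1_mulD1_le1 a n : 0 <= a <= 1 -> (1 - a) ^+ n * (1 + n%:R * a) <= 1.
Proof.
move=> /andP[a0 a1]; elim: n => [|n IH]; first by rewrite expr0 mul0r addr0 mulr1.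
apply: le_trans IH; rewrite exprSr -mulrA.
apply: ler_wpM2l; first by rewrite exprn_ge0// subr_ge0.
have -> : 1 + n%:R * a = (1 - a) * (1 + n.+1%:R * a) + n.+1%:R * a ^+ 2.
  by rewrite -natr1; ring.
by rewrite lerDl mulr_ge0// sqr_ge0.
Qed.

Lemma bernoulli_le a n : 0 <= a <= 1 -> 1 - n%:R * a <= (1 - a) ^+ n.
Proof.
move=> /andP[a0 a1]; elim: n => [|n IH]; first by rewrite mul0r subr0.
rewrite exprSr; apply: (@le_trans _ _ ((1 - n%:R * a) * (1 - a))).
  rewrite -natr1 -subr_ge0.
  rewrite [leRHS](_ : _ = n%:R * a ^+ 2); last by ring.
  by rewrite mulr_ge0// sqr_ge0.
by apply: ler_wpM2r => //; rewrite subr_ge0.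
Qed.

Lemma normr_exprB_le a b n : `|a| <= 1 -> `|b| <= 1 ->
  `|a ^+ n - b ^+ n| <= n%:R * `|a - b|.
Proof.
move=> a1 b1; rewrite subrXX normrM mulrC; apply: ler_wpM2r => //.
apply: (le_trans (ler_norm_sum _ _ _)).
rewrite -[n in leRHS]card_ord -sum1_card natr_sum; apply: ler_sum => i _.
by rewrite normrM !normrX mulr_ile1// exprn_ile1.
Qed.

(** The remainder of the cosine series after two terms is at most v^4 times the
    tail of a geometric series, since 2^(l + 1) <= (2l + 4)!. *)
Lemma normr_cosB_le v : `|v| <= 1 -> `|cos v - (1 - v ^+ 2 / 2)| <= v ^+ 4.
Proof.
move=> v1.
have v4 : 0 <= v ^+ 4 by rewrite (exprM v 2 2) sqr_ge0.
have vsq : v ^+ 2 <= 1 by rewrite -(real_normK (num_real v)) exprn_ile1.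
have term l : `|cos_coeff' v l.+2| <= v ^+ 4 * (2^-1) ^+ l.+1.
  rewrite /cos_coeff' -exprnP 2!normrM !normrX normrN1 expr1n mul1r.
  rewrite normfV normr_nat; apply: ler_pM => //.
  - rewrite -mul2n exprM real_normK ?num_real//.
    rewrite -[l.+2]addn2 addnC exprD -exprM.
    by rewrite ler_piMr// exprn_ile1// sqr_ge0.
  - rewrite exprVn lef_pV2 ?posrE ?exprn_gt0 ?ltr0n ?fact_gt0//.
    rewrite -natrX ler_nat; elim: l => [//|l IH].
    rewrite [(l.+3).*2]doubleS 2!factS expnS.
    by apply: leq_mul => //; apply: (leq_trans IH); rewrite leq_pmull.
have part n :
    `|series (cos_coeff' v) n.+2 - (1 - v ^+ 2 / 2)| <= v ^+ 4 * (1 - 2^-1 ^+ n).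
  elim: n => [|n IH].
    rewrite /series /= !big_nat_recr//= big_geq// /cos_coeff' -!exprnP /=.
    rewrite !expr0 expr1 !mul1r fact0 subrr mulr0.
    rewrite [X in `|X|](_ : _ = 0) ?normr0//.
    have -> : (1.*2)`!%:R = 2 :> R by [].
    by rewrite invr1 add0r -[1.*2]/2%N; field.
  rewrite /series /= big_nat_recr//= -/(series _ _) addrAC.
  apply: (le_trans (ler_normD _ _)).
  apply: (le_trans (lerD IH (term n))).
  by rewrite -mulrDr ler_wpM2l// exprS; lra.
have c : (fun n => `|series (cos_coeff' v) n.+2 - (1 - v ^+ 2 / 2)|) @ \oo -->
    `|cos v - (1 - v ^+ 2 / 2)|.
  apply: cvg_norm; apply: cvgB; last exact: cvg_cst.
  have := @cvg_cos_coeff' R v; rewrite -(cvg_shiftn 2).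
  by apply: cvg_trans; apply: near_eq_cvg; apply: nearW => n /=; rewrite addn2.
rewrite -(cvg_lim (@Rhausdorff R) c); apply: limr_le.
  by apply/cvg_ex; eexists; exact: c.
apply: nearW => n; apply: (le_trans (part n)).
by rewrite ler_piMr// lerBlDr lerDl exprn_ge0.
Qed.

Lemma normr_expRNB_le w : 0 <= w -> `|expR (- w) - (1 - w)| <= w ^+ 2.
Proof.
move=> w0; have := expR_ge1Dx (- w).
move=> h1; rewrite ger0_norm; last by lra.
have e : expR (- w) * (1 + w) <= 1.
  rewrite expRN mulrC ler_pdivrMr ?expR_gt0// mul1r; exact: expR_ge1Dx.
have w1 : 0 < 1 + w by lra.
have : expR (- w) <= 1 / (1 + w) by rewrite ler_pdivlMr.
have : 1 / (1 + w) <= 1 - w + w ^+ 2.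
  rewrite ler_pdivrMr//.
  rewrite (_ : (1 - w + w ^+ 2) * (1 + w) = 1 + w ^+ 3); last by ring.
  by rewrite lerDl exprn_ge0.
lra.
Qed.

(** The exponents are taken to be squares so that no square root appears.  Both
    cos v and exp (- v^2 / 2) are 1 - v^2 / 2 up to O(v^4); with v = b / m, taking
    the power m^2 leaves an error O(1 / m^2). *)
Lemma cvg_cos_expr b :
  (fun n => cos (b / n.+1%:R) ^+ (n.+1 ^ 2)) @ \oo --> expR (- (b ^+ 2 / 2)).
Proof.
have key : \forall n \near \oo,
    `|cos (b / n.+1%:R) ^+ (n.+1 ^ 2) - expR (- (b ^+ 2 / 2))| <=
    (2 * b ^+ 4) * @harmonic R n.
  near=> n.
  set v := b / n.+1%:R.
  have n0 : (0 : R) < n.+1%:R by rewrite ltr0n.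
  have v1 : `|v| <= 1.
    rewrite /v normrM normfV normr_nat ler_pdivrMr// mul1r.
    near: n; near_simpl.
    have [N hN] : exists N : nat, `|b| <= N%:R.
      by exists (Num.bound `|b|); rewrite ltW// archi_boundP.
    exists N => // n /= Nn; apply: (le_trans hN).
    by rewrite ler_nat (leq_trans Nn).
  have -> : expR (- (b ^+ 2 / 2)) = expR (- (v ^+ 2 / 2)) ^+ (n.+1 ^ 2).
    rewrite -expRM_natl; congr expR; rewrite /v natrX; field.
    by rewrite gt_eqF.
  apply: (le_trans (normr_exprB_le _ _ _)).
  - exact: cos_max.
  - by rewrite ger0_norm ?expR_ge0// expR_le1 oppr_le0 divr_ge0// sqr_ge0.
  - have h1 := normr_cosB_le v1.
    have h2 : `|expR (- (v ^+ 2 / 2)) - (1 - v ^+ 2 / 2)| <= (v ^+ 2 / 2) ^+ 2.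
      by apply: normr_expRNB_le; rewrite divr_ge0// sqr_ge0.
    have v4 : 0 <= v ^+ 4 by rewrite (exprM v 2 2) sqr_ge0.
    have : `|cos v - expR (- (v ^+ 2 / 2))| <= 2 * v ^+ 4.
      rewrite (_ : _ - _ = (cos v - (1 - v ^+ 2 / 2)) -
        (expR (- (v ^+ 2 / 2)) - (1 - v ^+ 2 / 2))); last by ring.
      apply: (le_trans (ler_normB _ _)); apply: (le_trans (lerD h1 h2)).
      rewrite (_ : (v ^+ 2 / 2) ^+ 2 = v ^+ 4 / 4); last by field.
      by lra.
    move=> h3; apply: (@le_trans _ _ ((n.+1 ^ 2)%:R * (2 * v ^+ 4))).
      by apply: ler_wpM2l => //; rewrite ler0n.
    rewrite (_ : _ * (2 * v ^+ 4) = (2 * b ^+ 4) * (n.+1%:R ^- 2)); last first.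
      by rewrite /v natrX; field; rewrite gt_eqF.
    apply: ler_wpM2l.
      by rewrite mulr_ge0// (exprM b 2 2) sqr_ge0.
    rewrite /harmonic /= lef_pV2 ?posrE ?exprn_gt0//.
    by rewrite -natrX ler_nat leq_pmulr.
have h0 : (fun n => (2 * b ^+ 4) * @harmonic R n) @ \oo --> (0 : R).
  rewrite -(mulr0 (2 * b ^+ 4)); apply: cvgM; [exact: cvg_cst|exact: cvg_harmonic].
apply/cvgrPdist_le => e e0.
have /cvgrPdist_le/(_ e e0) h := h0.
near=> n.
rewrite distrC; apply: (@le_trans _ _ ((2 * b ^+ 4) * @harmonic R n)).
  by near: n.
apply: (le_trans (ler_norm _)).
rewrite -normrN -sub0r; near: n; exact: h.
Unshelve. all: end_near. Qed.

(** Polynomials in u converging on [0, 1] to the indicator of u < 1/2.  The factor n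
    in the exponent makes the limit at u = 1/2 vanish: without it, it would be
    exp (- 1). *)
Definition threshold (n : nat) (u : R) : R := (1 - u ^+ n) ^+ (n * 2 ^ n).

Lemma threshold_bounded n u : 0 <= u <= 1 -> 0 <= threshold n u <= 1.
Proof.
move=> /andP[u0 u1]; have : 0 <= u ^+ n <= 1 by rewrite exprn_ge0// exprn_ile1.
move=> /andP[v0 v1]; rewrite /threshold exprn_ge0 ?exprn_ile1//; lra.
Qed.

(** By Bernoulli, 1 - threshold n u <= n (2u)^n; with q = sqrt (2u) < 1 the factor
    n q^n is bounded by 1 / (1 - q), and the remaining q^n tends to 0. *)
Lemma cvg_threshold_lt u : 0 <= u -> u < 2^-1 -> threshold ^~ u @ \oo --> (1 : R).
Proof.
move=> u0 u2.
have u1 : 0 <= u <= 1 by rewrite u0 /=; lra.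
pose q := Num.sqrt (2 * u).
have q0 : 0 <= q by exact: sqrtr_ge0.
have qq : q ^+ 2 = 2 * u by rewrite sqr_sqrtr// mulr_ge0.
have q1 : q < 1 by rewrite ltNge; apply/negP => h; have := exprn_ege1 2 h; lra.
have d0 : 0 < 1 - q by lra.
apply: (@squeeze_cvgr _ _ _ _ (fun n => 1 - q ^+ n / (1 - q)) (cst 1)).
- apply: nearW => n; rewrite (andP (threshold_bounded n u1)).2 andbT.
  have un : 0 <= u ^+ n <= 1.
    by rewrite exprn_ge0// exprn_ile1//; case/andP: u1.
  apply: le_trans (bernoulli_le (n * 2 ^ n) un).
  rewrite lerD2l lerN2 natrM natrX -mulrA -exprMn -qq -exprM mulnC exprM expr2.
  rewrite mulrA [leRHS]mulrC; apply: ler_wpM2r; first exact: exprn_ge0.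
  rewrite -[leRHS]mul1r ler_pdivlMr//.
  have /(exprB1_mulD1_le1 n) : 0 <= 1 - q <= 1 by lra.
  rewrite opprB addrC subrK mulrDr mulr1; apply: le_trans.
  rewrite [leRHS](_ : _ = q ^+ n + n%:R * q ^+ n * (1 - q)); last by ring.
  by rewrite lerDr exprn_ge0.
- rewrite -[X in _ --> X]subr0; apply: cvgB; first exact: cvg_cst.
  rewrite -(mul0r (1 - q)^-1); apply: cvgM; last exact: cvg_cst.
  by apply: cvg_expr; rewrite ger0_norm.
- exact: cvg_cst.
Qed.

(** Here (1 - a)^m <= 1 / (1 + m a) with a = u^n and m = n 2^n, so that m a >= n. *)
Lemma cvg_threshold_ge u : 2^-1 <= u -> u <= 1 -> threshold ^~ u @ \oo --> (0 : R).
Proof.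
move=> u2 u1'.
have u0 : 0 <= u by lra.
have u1 : 0 <= u <= 1 by rewrite u0.
apply: (@squeeze_cvgr _ _ _ _ (cst 0) (@harmonic R)).
- apply: nearW => n; rewrite (andP (threshold_bounded n u1)).1 /=.
  have un : 0 <= u ^+ n <= 1 by rewrite exprn_ge0// exprn_ile1.
  have := exprB1_mulD1_le1 (n * 2 ^ n) un.
  rewrite -/(threshold n u) /harmonic /= => h.
  rewrite -[leRHS]mul1r ler_pdivlMr ?ltr0n//; apply: le_trans h.
  apply: ler_wpM2l; first by case/andP: (threshold_bounded n u1).
  rewrite -natr1 addrC lerD2l natrM natrX -mulrA -exprMn ler_peMr//.
  by rewrite exprn_ege1//; lra.
- exact: cvg_cst.
- exact: cvg_harmonic.
Qed.

End real_limits.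

(** * From cosine integrals to tails *)

Section cosines_determine.
Context d (T : measurableType d) (R : realType) (mu nu : probability T R).
Variable phi : T -> R.
Hypothesis cos_agree : forall t, agree mu nu (fun x => cos (t * phi x)).

(** The addition formulas linearise products of cosines. *)
Let cosM_agree (t s : R) n :
  agree mu nu (fun x => cos (t * phi x) * cos (s * phi x) ^+ n).
Proof.
elim: n t => [|n IH] t.
  by apply: eq_agree (cos_agree t) => x; rewrite expr0 mulr1.
apply: eq_agree (agreeZ (2^-1) (agreeD (IH (t + s)) (IH (t - s)))) => x.
by rewrite exprS !mulrDl mulNr !cosD cosN sinN; field.
Qed.

(** Bounded limit of the functions [cos (c * phi x / m) ^+ (m ^ 2)]. *)
Lemma agree_gauss (s : R) : 0 <= s ->
  agree mu nu (fun x => expR (- (s * phi x ^+ 2))).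
Proof.
move=> s0; pose c := Num.sqrt (2 * s).
have cc : c ^+ 2 = 2 * s by rewrite sqr_sqrtr// mulr_ge0.
apply: (@agree_bounded_cvg _ _ _ mu nu
  (fun n x => cos (c * phi x / n.+1%:R) ^+ (n.+1 ^ 2)) _ 1).
- move=> n; apply: eq_agree (cosM_agree 0 (c / n.+1%:R) (n.+1 ^ 2)) => x.
  by rewrite mul0r cos0 mul1r mulrAC.
- move=> x; have -> : s * phi x ^+ 2 = (c * phi x) ^+ 2 / 2.
    by rewrite exprMn cc; field.
  exact: cvg_cos_expr.
- by move=> n x; rewrite normrX exprn_ile1// cos_max.
Qed.

Let threshold_agree (s : R) n : 0 <= s ->
  agree mu nu (fun x => threshold n (expR (- (s * phi x ^+ 2)))).
Proof.
move=> s0.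
have eX j x : expR (- (s * phi x ^+ 2)) ^+ j = expR (- (j%:R * s * phi x ^+ 2)).
  by rewrite -expRM_natl mulrN mulrA.
suff H k : forall j, agree mu nu (fun x =>
    expR (- (s * phi x ^+ 2)) ^+ j * (1 - expR (- (s * phi x ^+ 2)) ^+ n) ^+ k).
  by apply: eq_agree (H (n * 2 ^ n)%N 0%N) => x; rewrite expr0 mul1r.
elim: k => [|k IH] j.
  have /agree_gauss : 0 <= j%:R * s by rewrite mulr_ge0.
  by apply: eq_agree => x; rewrite expr0 mulr1 eX.
apply: eq_agree (agreeD (IH j) (agreeZ (-1) (IH (j + n)%N))) => x.
by rewrite exprD (exprS _ k); ring.
Qed.

(** Powers of u = exp (- s phi^2) are again of this form, so polynomials in u have
    the same integral.  For x0 > 0 the choice s = ln 2 / x0 puts the jump u = 1/2 of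
    the limit of [threshold] at phi^2 = x0; for x0 = 0 the functions
    1 - exp (- n phi^2) do. *)
Lemma agree_tail (x0 : R) : 0 <= x0 -> measurable_fun setT phi ->
  mu [set x | x0 < phi x ^+ 2] = nu [set x | x0 < phi x ^+ 2].
Proof.
move=> x00 mphi; set A := [set x | _].
have mA : measurable A.
  rewrite -[A]setTI; apply: (measurable_fun_ltr (f := cst x0)) => //.
  exact: measurable_funX.
suff : agree mu nu (\1_A : T -> R).
  by move=> [_ _]; rewrite !integral_indic// !setIT.
move: x00; rewrite le_eqVlt => /predU1P[x00|x00].
  apply: (@agree_bounded_cvg _ _ _ mu nu
    (fun n x => 1 - expR (- (n%:R * phi x ^+ 2))) _ 1).
  - move=> n.
    have g0 := agree_gauss (lexx 0); have gn := agree_gauss (ler0n R n).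
    apply: eq_agree (agreeD g0 (agreeZ (-1) gn)) => x.
    by rewrite mul0r oppr0 expR0 mulN1r.
  - move=> x; rewrite indicE; case: (boolP (x \in A)) => [|].
      rewrite inE /A /= -x00 => px.
      rewrite -[X in _ --> X]subr0; apply: cvgB; first exact: cvg_cst.
      have -> : (fun n => expR (- (n%:R * phi x ^+ 2))) =
          (fun n => expR (- phi x ^+ 2) ^+ n).
        by apply/funext => n; rewrite -expRM_natl mulrN.
      apply: cvg_expr; rewrite ger0_norm ?expR_ge0// expR_lt1; lra.
    rewrite notin_setE /A /= -x00 => /negP; rewrite -leNgt => px.
    have -> : phi x ^+ 2 = 0 by apply/le_anti; rewrite px sqr_ge0.
    by under eq_fun do rewrite mulr0 oppr0 expR0 subrr; exact: cvg_cst.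
  - move=> n x; rewrite ger0_norm.
      by have := expR_ge0 (- (n%:R * phi x ^+ 2)); lra.
    by rewrite subr_ge0 expR_le1 oppr_le0 mulr_ge0// sqr_ge0.
pose s := ln 2 / x0.
have l2 : 0 < ln (2 : R) by rewrite ln_gt0// ltr1n.
have s0 : 0 <= s by exact: (divr_ge0 (ltW l2) (ltW x00)).
have e1 x : 0 <= expR (- (s * phi x ^+ 2)) <= 1.
  by rewrite expR_ge0/= expR_le1 oppr_le0 mulr_ge0// sqr_ge0.
have half : 2^-1 = expR (- (s * x0)).
  by rewrite /s mulfVK ?gt_eqF// expRN lnK// posrE.
have sgt0 : 0 < s by rewrite divr_gt0.
apply: (@agree_bounded_cvg _ _ _ mu nu _ _ 1 (fun n => threshold_agree n s0)).
- move=> x; rewrite indicE; case: (boolP (x \in A)) => [|].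
    rewrite inE /A /= => px; apply: cvg_threshold_lt; first exact: expR_ge0.
    by rewrite half ltr_expR ltrN2 ltr_pM2l.
  rewrite notin_setE /A /= => /negP; rewrite -leNgt => px.
  apply: cvg_threshold_ge; last by case/andP: (e1 x).
  by rewrite half ler_expR lerN2 ler_pM2l.
- move=> n x; have /andP[b0 b1] := threshold_bounded n (e1 x).
  by rewrite ger0_norm.
Qed.

End cosines_determine.

(** * Determinacy on the half-line *)

Section stieltjes_moments.
Context (R : realType).
Implicit Types (mu nu m : probability R R).

Lemma eq_probability_tails mu nu :
  (forall x : R, mu `]x, +oo[%classic = nu `]x, +oo[%classic) ->
  forall A, measurable A -> mu A = nu A.
Proof.
move=> tl A mA.
apply: (@measure_unique _ R R (@RGenOInfty.G R)
    (fun n => `](- n%:R), +oo[%classic) _ _ _ _ mu nu).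
- exact: RGenOInfty.measurableE.
- move=> _ _ [x ->] [y ->]; exists (Num.max x y).
  by rewrite predeqE => z; rewrite /= !in_itv /= !andbT gt_max; split=> /andP.
- by move=> n; exists (- n%:R).
- rewrite -subTset => x _; exists (Num.bound `|x|) => //=.
  rewrite in_itv/= andbT ltrNl; apply: (le_lt_trans (ler_norm _)).
  by rewrite normrN archi_boundP.
- by move=> _ [x ->]; exact: tl.
- by move=> n; rewrite ltey_eq fin_num_measure.
- by [].
Qed.

(** With L = C^l (2l)!, the inequality |x|^l <= (L + x^(2l) / L) / 2 bounds absolute
    moments of all orders by the even moments. *)
Lemma abs_moment_bounded m (M C : R) : 0 < C ->
    (forall k : nat, m.-integrable setT (fun x => (x ^+ k)%:E)) ->
    (forall k : nat, (\int[m]_x (x ^+ k)%:E <= (M * (C ^+ k * k`!%:R ^+ 2))%:E)%E) ->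
  moment_bounded m (cst 1) ((1 + M) / 2) C.
Proof.
move=> C0 im bm l; set L := C ^+ l * _.
have L0 : 0 < L by rewrite mulr_gt0 ?exprn_gt0// ltr0n fact_gt0.
pose q (x : R) : R := L / 2 + (2 * L)^-1 * x ^+ l.*2.
have i1 : m.-integrable setT (EFin \o cst (L / 2)).
  exact: finite_measure_integrable_cst.
have i2 : m.-integrable setT (EFin \o (fun x => (2 * L)^-1 * x ^+ l.*2)).
  exact: (integrableZl measurableT (2 * L)^-1 (im l.*2)).
have iq : m.-integrable setT (EFin \o q) := integrableD measurableT i1 i2.
have pq x : `|x| ^+ l * `|cst 1 x| <= q x.
  rewrite /= normr1 mulr1 /q -mul2n mulnC exprM -(real_normK (num_real (x ^+ l))).
  rewrite normrX; set y := `|x| ^+ l.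
  rewrite -subr_ge0 [leRHS](_ : _ = (L - y) ^+ 2 / (2 * L)).
    by rewrite divr_ge0 ?sqr_ge0// mulr_ge0// ltW.
  by field; rewrite gt_eqF.
apply: (@le_trans _ _ (\int[m]_x (q x)%:E)%E).
  apply: ge0_le_integral.
  - exact: measurableT.
  - by move=> x _; rewrite lee_fin mulr_ge0// exprn_ge0.
  - by apply: measurable_absX_mul; exact: measurable_cst.
  - exact: (measurable_int m iq).
  - by move=> x _; rewrite lee_fin.
rewrite (integralD_EFin measurableT i1 i2) /=.
rewrite integral_cst// [X in (_ * X + _)%E](_ : _ = 1%E); last exact: probability_setT.
rewrite mule1.
under eq_integral do rewrite EFinM.
rewrite (integralZl measurableT (im l.*2)).
have k0 : 0 <= (2 * L)^-1 by rewrite invr_ge0 mulr_ge0// ltW.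
apply: (le_trans (leeD2l _ (lee_wpmul2l _ (bm l.*2)))); first by rewrite lee_fin.
rewrite -EFinM -EFinD lee_fin.
rewrite [C ^+ _ * _](_ : _ = L ^+ 2); last by rewrite /L exprMn -exprM muln2.
by rewrite le_eqVlt; apply/orP; left; apply/eqP; field; rewrite gt_eqF.
Qed.

(** For x < 0 the first term on the right is already the left-hand side, because
    [cosroot t] is positive there; for x >= 0 the second term absorbs the sign,
    because [cosroot t] is at most 1 in absolute value.  Integrating, the signed
    moments of [cosroot t] control its absolute moments. *)
Lemma le_abs_cosroot t x l : `|x| ^+ l * `|cosroot t x| <=
  (-1) ^+ l * (x ^+ l * cosroot t x) + 2 * (`|x| ^+ l * `|cst (1 : R) x|).
Proof.
have xl0 : 0 <= `|x| ^+ l by rewrite exprn_ge0.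
rewrite /= normr1 mulr1; case: (leP 0 x) => x0.
  have c1 := normr_cosroot_le1 t x0.
  have h : `|(-1) ^+ l * (x ^+ l * cosroot t x)| <= `|x| ^+ l.
    by rewrite !normrM !normrX normrN1 expr1n mul1r ler_piMr.
  have h2 : `|x| ^+ l * `|cosroot t x| <= `|x| ^+ l by rewrite ler_piMr.
  move: h; rewrite ler_norml => /andP[h _]; lra.
rewrite mulrA -exprMn mulN1r -(ltr0_norm x0) (gtr0_norm (cosroot_lt0_gt0 t x0)).
by rewrite lerDl mulr_ge0.
Qed.

Section determinacy.
Variables (mu nu : probability R R) (M C : R).
Hypothesis M0 : 0 <= M.
Hypothesis C0 : 0 < C.
Hypothesis xk_agree : forall k, agree mu nu (fun x => x ^+ k).
Hypothesis nu_bound : forall k : nat,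
  (\int[nu]_x (x ^+ k)%:E <= (M * (C ^+ k * k`!%:R ^+ 2))%:E)%E.
Hypothesis nu_ge0 : {ae nu, forall x : R, 0 <= x}.

Let B := (1 + M) / 2.
Let B0 : 0 <= B. Proof. by rewrite divr_ge0// addr_ge0. Qed.

Let bound_nu : moment_bounded nu (cst 1) B C.
Proof. by apply: abs_moment_bounded => // k; case: (xk_agree k). Qed.

Let bound_mu : moment_bounded mu (cst 1) B C.
Proof.
apply: abs_moment_bounded => // k; first by case: (xk_agree k).
by case: (xk_agree k) => _ _ ->.
Qed.

Let bound_nu_cosroot t : moment_bounded nu (cosroot t) B C.
Proof.
move=> l; apply: le_trans (bound_nu l).
apply: ae_ge0_le_integral.
- exact: measurableT.
- by move=> x _; rewrite lee_fin mulr_ge0// exprn_ge0.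
- by apply: measurable_absX_mul; exact: measurable_cosroot.
- by move=> x _; rewrite lee_fin mulr_ge0// exprn_ge0.
- by apply: measurable_absX_mul; exact: measurable_cst.
- apply: filterS nu_ge0 => x x0 _.
  rewrite lee_fin; apply: ler_wpM2l; first by rewrite exprn_ge0.
  by rewrite /= normr1 normr_cosroot_le1.
Qed.

Let abs_integrable m (w : R -> R) (B1 : R) l : measurable_fun setT w ->
  moment_bounded m w B1 C ->
  m.-integrable setT (fun x : R => (`|x| ^+ l * `|w x|)%:E).
Proof.
move=> mw bw; apply/integrableP; split; first exact: measurable_absX_mul.
under eq_integral do rewrite gee0_abs ?lee_fin ?mulr_ge0 ?exprn_ge0//.
by apply: (le_lt_trans (bw l)); rewrite ltry.
Qed.

(** This bound is uniform in t, so the step h in the induction below never has to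
    shrink. *)
Let bound_mu_cosroot t : (forall k, agree mu nu (fun x => x ^+ k * cosroot t x)) ->
  moment_bounded mu (cosroot t) (3 * B) C.
Proof.
move=> ac l; have [im inu e] := ac l.
have mc := measurable_cosroot t.
pose s : R := (-1) ^+ l.
have s1 : `|s| = 1 by rewrite normrX normrN1 expr1n.
have i1 : mu.-integrable setT (EFin \o (fun x => s * (x ^+ l * cosroot t x))).
  exact: (integrableZl measurableT s im).
have ia : mu.-integrable setT (EFin \o (fun x : R => `|x| ^+ l * `|cst 1 x|)).
  exact: (abs_integrable l (measurable_cst _) bound_mu).
have i2 : mu.-integrable setT (EFin \o (fun x : R => 2 * (`|x| ^+ l * `|cst 1 x|))).
  exact: (integrableZl measurableT 2 ia).
apply: (@le_trans _ _ (\int[mu]_x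
    (s * (x ^+ l * cosroot t x) + 2 * (`|x| ^+ l * `|cst 1 x|))%:E)%E).
  apply: ge0_le_integral.
  - exact: measurableT.
  - by move=> x _; rewrite lee_fin mulr_ge0// exprn_ge0.
  - exact: measurable_absX_mul.
  - exact: (measurable_int mu (integrableD measurableT i1 i2)).
  - by move=> x _; rewrite lee_fin; exact: le_abs_cosroot.
rewrite (integralD_EFin measurableT i1 i2) /=.
under eq_integral do rewrite EFinM.
rewrite (integralZl measurableT im).
under [X in (_ + X)%E]eq_integral do rewrite EFinM.
rewrite (integralZl measurableT ia) e.
rewrite (_ : 3 * B * _ = B * (C ^+ l * (l.*2)`!%:R) + 2 * (B * (C ^+ l * (l.*2)`!%:R)));
  last by ring.
rewrite [leRHS]EFinD; apply: leeD; last first.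
  by rewrite [leRHS]EFinM; apply: lee_wpmul2l => //; exact: bound_mu.
rewrite -(integralZl measurableT inu).
apply: le_trans (bound_nu_cosroot t l).
apply: (le_trans (lee_abs _)); apply: (le_trans (le_abse_integral _ _ _)) => //.
  exact: (measurable_int nu (integrableZl measurableT s inu)).
rewrite le_eqVlt; apply/orP; left; apply/eqP; apply: eq_integral => x _.
by rewrite -EFinM abse_EFin !normrM s1 mul1r normrX.
Qed.

Let bound_nu_cosroot3 t : moment_bounded nu (cosroot t) (3 * B) C.
Proof.
move=> l; apply: (le_trans (bound_nu_cosroot t l)); rewrite lee_fin.
apply: ler_wpM2r; first by rewrite mulr_ge0 ?ler0n// exprn_ge0// ltW.
by have := B0; lra.
Qed.

Let agree_cosrootM t h : 8 * h ^+ 2 * C <= 1 ->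
  (forall k, agree mu nu (fun x => x ^+ k * cosroot t x)) ->
  forall k, agree mu nu (fun x => x ^+ k * (cosroot t x * cosroot h x)).
Proof.
move=> hC ac.
have B3 : 0 <= 3 * B by rewrite mulr_ge0.
exact: (agree_mul_cosroot (measurable_cosroot t) B3 (ltW C0) hC
  (bound_mu_cosroot ac) (bound_nu_cosroot3 t) ac).
Qed.

(** Two consecutive multiples of h are needed to apply [cosrootDB]. *)
Let agree_cosroot_iter h j : 8 * h ^+ 2 * C <= 1 ->
  (forall k, agree mu nu (fun x => x ^+ k * cosroot (j%:R * h) x)) /\
  (forall k, agree mu nu (fun x => x ^+ k * cosroot (j.+1%:R * h) x)).
Proof.
move=> hC; elim: j => [|j [IH0 IH1]].
  have a0 k : agree mu nu (fun x => x ^+ k * cosroot (0%:R * h) x).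
    by apply: eq_agree (xk_agree k) => x; rewrite mul0r cosroot0 mulr1.
  split=> // k; apply: eq_agree (agree_cosrootM hC a0 k) => x.
  by rewrite mul0r cosroot0 !mul1r.
split=> // k.
apply: eq_agree
  (agreeD (agreeZ 2 (agree_cosrootM hC IH1 k)) (agreeZ (-1) (IH0 k))) => x.
have := cosrootDB (j.+1%:R * h) h x.
have -> : j.+1%:R * h + h = j.+2%:R * h by rewrite -[in RHS]natr1 mulrDl mul1r.
have -> : j.+1%:R * h - h = j%:R * h by rewrite -natr1 mulrDl mul1r addrK.
by move=> e; rewrite mulrCA -e; ring.
Qed.

Let agree_cosroot t : agree mu nu (cosroot t).
Proof.
pose j := Num.bound (8 * t ^+ 2 * C).
have hj : 8 * t ^+ 2 * C < j%:R.
  by rewrite archi_boundP// mulr_ge0 ?(ltW C0)// mulr_ge0// sqr_ge0.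
have j0 : 0 < j.+1%:R :> R by rewrite ltr0n.
have hC : 8 * (t / j.+1%:R) ^+ 2 * C <= 1.
  rewrite (_ : _ * C = 8 * t ^+ 2 * C / j.+1%:R ^+ 2); last first.
    by field; rewrite gt_eqF.
  rewrite ler_pdivrMr ?exprn_gt0// mul1r; apply: (le_trans (ltW hj)).
  rewrite -natrX ler_nat; apply: (@leq_trans j.+1) => //.
  by rewrite -mulnn leq_pmulr.
have [_ /(_ 0%N)] := agree_cosroot_iter j hC.
apply: eq_agree => x; rewrite expr0 mul1r; congr cosroot.
by rewrite mulrC divfK// gt_eqF.
Qed.

(** With f x the negative part of x, (t^2 / 4) f x <= 1 + cosroot t x; the integral
    of the right-hand side under mu equals that under nu, which is at most 1 + B
    for every t. *)
Let mu_ge0 : {ae mu, forall x : R, 0 <= x}.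
Proof.
pose f (x : R) : R := (`|x| - x) / 2.
have f0 x : 0 <= f x by rewrite /f divr_ge0// subr_ge0 ler_norm.
have i_f : mu.-integrable setT (EFin \o f).
  have ia : mu.-integrable setT (EFin \o (fun x : R => `|x|)).
    have := abs_integrable 1 (measurable_cst _) bound_mu.
    by apply: eq_integrable => // x _; rewrite expr1 normr1 mulr1.
  have ix : mu.-integrable setT (EFin \o (fun x : R => x)).
    by case: (xk_agree 1) => + _ _; apply: eq_integrable.
  have := integrableZl measurableT 2^-1 (integrableB measurableT ia ix).
  by apply: eq_integrable => // x _; rewrite /f /= -EFinB -EFinM mulrC.
have fle t : 0 <= t -> t ^+ 2 / 4 * (\int[mu]_x f x)%R <= 1 + B.
  move=> t0; have [ic icn e] := agree_cosroot t.
  have i1 : mu.-integrable setT (EFin \o cst (1 : R)).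
    exact: finite_measure_integrable_cst.
  have iZ : mu.-integrable setT (EFin \o (fun x => t ^+ 2 / 4 * f x)).
    exact: (integrableZl measurableT _ i_f).
  rewrite -RintegralZl//.
  apply: (@le_trans _ _ (\int[mu]_x (cst 1 x + cosroot t x))%R).
    apply: le_Rintegral => //; first exact: (integrableD measurableT i1 ic).
    move=> x _; rewrite /= /f; case: (leP 0 x) => x0.
      rewrite ger0_norm// subrr mul0r mulr0.
      by have := normr_cosroot_le1 t x0; rewrite ler_norml => /andP[]; lra.
    have := cosroot_lt0_ge t0 x0; rewrite ltr0_norm//; set y := t ^+ 2; nra.
  rewrite RintegralD//; apply: lerD.
    rewrite Rintegral_cst// [X in fine X](_ : _ = 1%E) ?mul1r//.
    exact: probability_setT.
  rewrite /Rintegral e -lee_fin fineK ?integrable_fin_num//.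
  have := bound_nu_cosroot t 0; rewrite expr0 mul1r mulr1; apply: le_trans.
  apply: (le_trans (lee_abs _)); apply: (le_trans (le_abse_integral _ _ _)) => //.
    exact: (measurable_int nu icn).
  rewrite le_eqVlt; apply/orP; left; apply/eqP; apply: eq_integral => x _.
  by rewrite abse_EFin expr0 mul1r.
have I0 : (\int[mu]_x f x)%R = 0.
  apply/eqP; rewrite eq_le Rintegral_ge0// andbT leNgt; apply/negP => I1.
  have := fle _ (sqrtr_ge0 (4 * (2 + B) / (\int[mu]_x f x)%R)).
  rewrite sqr_sqrtr; last first.
    by rewrite divr_ge0 ?(ltW I1)// mulr_ge0// addr_ge0.
  rewrite [leLHS](_ : _ = 2 + B); last by field; rewrite gt_eqF.
  by lra.
have : (\int[mu]_x `|(f x)%:E| = 0)%E.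
  under eq_integral do rewrite gee0_abs ?lee_fin//.
  by rewrite -[LHS]fineK ?integrable_fin_num//; congr EFin.
move/ae_eq_integral_abs => /(_ measurableT (measurable_int mu i_f)).
apply: filterS => x /(_ I) [] /eqP; rewrite /f mulf_eq0 invr_eq0 pnatr_eq0 orbF.
by rewrite subr_eq0 => /eqP <-.
Qed.

Let bounded_integrable m (g : R -> R) (K : R) : measurable_fun setT g ->
  (forall x, `|g x| <= K) -> m.-integrable setT (EFin \o g).
Proof.
move=> mg gK; apply: (@le_integrable _ _ _ m setT measurableT _ (EFin \o cst K)).
- exact/measurable_EFinP.
- move=> x _; rewrite /= lee_fin; apply: (le_trans (gK x)); exact: ler_norm.
- exact: finite_measure_integrable_cst.
Qed.

Let agree_cos_sqrt t : agree mu nu (fun x => cos (t * Num.sqrt x)).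
Proof.
have mc : measurable_fun setT (fun x : R => cos (t * Num.sqrt x)).
  apply: measurableT_comp.
    by apply: continuous_measurable_fun; exact: continuous_cos.
  apply: measurable_funM => //.
  by apply: continuous_measurable_fun; exact: sqrt_continuous.
have E m : {ae m, forall x : R, 0 <= x} ->
    (\int[m]_x (cos (t * Num.sqrt x))%:E = \int[m]_x (cosroot t x)%:E)%E.
  move=> m0; apply: ae_eq_integral => //.
  - exact/measurable_EFinP.
  - by apply/measurable_EFinP; exact: measurable_cosroot.
  - by apply: filterS m0 => x x0 _; rewrite /cosroot x0.
have K x : `|cos (t * Num.sqrt x)| <= 1 by exact: cos_max.
split; [exact: bounded_integrable K|exact: bounded_integrable K|].
by rewrite (E mu mu_ge0) (E nu nu_ge0); case: (agree_cosroot t).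
Qed.

(** On the half-line [cosroot t x] is [cos (t * Num.sqrt x)], and [Num.sqrt] is 0 on the
    negatives, so [agree_tail] with phi the square root yields all the tails
    from nonnegative points. *)
Lemma eq_probability_moments A : measurable A -> mu A = nu A.
Proof.
apply: eq_probability_tails => x; case: (leP 0 x) => x0.
  have -> : `]x, +oo[%classic = [set y : R | x < Num.sqrt y ^+ 2].
    apply/seteqP; split => y /=; rewrite in_itv/= andbT.
      by move=> xy; rewrite sqr_sqrtr// (le_trans x0)// ltW.
    case: (leP 0 y) => y0; first by rewrite sqr_sqrtr.
    by rewrite ler0_sqrtr ?ltW// expr0n/= ltNge x0.
  apply: (agree_tail agree_cos_sqrt x0).
  by apply: continuous_measurable_fun; exact: sqrt_continuous.
have E m : {ae m, forall x : R, 0 <= x} -> m `]x, +oo[%classic = 1%E.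
  move=> m0; rewrite -[X in m X]setIT -integral_indic//.
  rewrite (ae_eq_integral (cst 1%E))//.
  - by rewrite integral_cst// mul1e; exact: probability_setT.
  - by apply/measurable_EFinP; exact: measurable_indic.
  - apply: filterS m0 => y y0 _; rewrite indicE mem_set//= in_itv/= andbT.
    exact: lt_le_trans y0.
by rewrite (E mu mu_ge0) (E nu nu_ge0).
Qed.

End determinacy.
End stieltjes_moments.

(** * Products of independent variables *)

Section independence.
Context (R : realType) (d d' : measure_display) (T : measurableType d)
  (T' : measurableType d') (P : probability T R).
Import HBNNSimple.

Let integral_simpleM (X : T -> T') (h : {nnsfun T' >-> R}) (K : T -> R) :
    measurable_fun setT X -> measurable_fun setT K -> (forall w, 0 <= K w) ->
  (\int[P]_w (h (X w) * K w)%:E = \sum_(y \in range h)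
     (y%:E * \int[P]_w (\1_(h @^-1` [set y]) (X w) * K w)%:E))%E.
Proof.
move=> mX mK K0.
have mt y : measurable_fun setT (fun w => \1_(h @^-1` [set y]) (X w) * K w).
  apply: measurable_funM => //.
  by apply: (measurableT_comp _ mX); apply: measurable_indic; exact: measurable_funPTI.
have t0 y w : 0 <= y * \1_(h @^-1` [set y]) (X w).
  by have := nnfun_muleindic_ge0 h y (X w); rewrite -EFinM lee_fin.
transitivity (\int[P]_w (\sum_(y \in range h)
    (y * (\1_(h @^-1` [set y]) (X w) * K w))%:E))%E.
  apply: eq_integral => w _.
  rewrite EFinM fimfunE -fsumEFin// ge0_mule_fsuml; last first.
    by move=> y; rewrite lee_fin.
  by apply: eq_fsbigr => y _; rewrite mulrA EFinM.
rewrite ge0_integral_fsum//.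
- apply: eq_fsbigr => y; rewrite inE => -[x _ <-].
  under eq_integral do rewrite EFinM.
  rewrite ge0_integralZl_EFin//; last exact/measurable_EFinP.
  by move=> w _; rewrite lee_fin mulr_ge0.
- by move=> y; apply/measurable_EFinP; exact: measurable_funM.
- by move=> y w _; rewrite lee_fin mulrA mulr_ge0.
Qed.

(** The standard extension from indicators to simple functions to nonnegative
    measurable functions.  An inequality is all that the moment bound requires, and
    it survives the monotone limit even when c is infinite. *)
Lemma le_integral_mul_of_indic (X : T -> T') (G : T -> R) (c : \bar R) :
    measurable_fun setT X -> measurable_fun setT G -> (forall w, 0 <= G w) ->
    (0 <= c)%E ->
    (forall A, measurable A ->
      (\int[P]_w (\1_A (X w) * G w)%:E <= \int[P]_w (\1_A (X w))%:E * c)%E) ->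
  forall f : T' -> R, measurable_fun setT f -> (forall x, 0 <= f x) ->
  (\int[P]_w (f (X w) * G w)%:E <= \int[P]_w (f (X w))%:E * c)%E.
Proof.
move=> mX mG G0 c0 HA f mf f0.
have mEf : measurable_fun setT (EFin \o f) by exact/measurable_EFinP.
pose h := nnsfun_approx measurableT mEf.
have hnd x : {homo (fun n => h n x) : n m / (n <= m)%N >-> n <= m}.
  by move=> n m nm; apply/lefP/nd_nnsfun_approx.
have hcvg x : (fun n => (h n x)%:E) @ \oo --> (f x)%:E.
  by apply: (cvg_nnsfun_approx measurableT mEf) => // y _; rewrite lee_fin.
have hcvgR x : (fun n => h n x) @ \oo --> f x.
  by have /fine_cvgP[_] := hcvg x.
have hle n x : h n x <= f x.
  rewrite -(cvg_lim (@Rhausdorff R) (hcvgR x)).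
  apply: nondecreasing_cvgn_le; first by move=> i j; exact: hnd.
  by apply/cvg_ex; exists (f x); exact: hcvgR.
have mh n : measurable_fun setT (fun w => h n (X w)) by exact: measurableT_comp.
have hG n : (\int[P]_w (h n (X w) * G w)%:E <= \int[P]_w (f (X w))%:E * c)%E.
  rewrite integral_simpleM//.
  apply: (@le_trans _ _ (\int[P]_w (h n (X w) * cst 1 w)%:E * c)%E).
    rewrite integral_simpleM// ge0_mule_fsuml; last first.
      move=> y; case: (ltP y 0) => y0.
        rewrite preimage_nnfun0// (eq_integral (cst 0%E)) ?integral0 ?mule0//.
        by move=> w _; rewrite indicE in_set0 mul0r.
      apply: mule_ge0; first by rewrite lee_fin.
      by apply: integral_ge0 => w _; rewrite /= lee_fin mulr1.
    apply: lee_fsum => // y [x _ <-]; rewrite -muleA.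
    apply: lee_wpmul2l; first by rewrite lee_fin.
    apply: (le_trans (HA _ _)); first exact: measurable_funPTI.
    by under [in leRHS]eq_integral do rewrite /= mulr1.
  apply: lee_wpmul2r => //; apply: ge0_le_integral => //.
  - by move=> w _; rewrite lee_fin mulr1.
  - by apply/measurable_EFinP; exact: measurable_funM.
  - by apply/measurable_EFinP; exact: measurableT_comp.
  - by move=> w _; rewrite lee_fin mulr1.
have mhG n : measurable_fun setT (fun w => (h n (X w) * G w)%:E).
  by apply/measurable_EFinP; exact: measurable_funM.
have hG0 n w : (0 <= (h n (X w) * G w)%:E)%E by rewrite lee_fin mulr_ge0.
have hGnd w : {homo (fun n => (h n (X w) * G w)%:E) : n m / (n <= m)%N >-> (n <= m)%E}.
  by move=> n m nm; rewrite lee_fin ler_wpM2r// hnd.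
have E : (\int[P]_w (f (X w) * G w)%:E =
    \int[P]_w (limn (fun n => (h n (X w) * G w)%:E)))%E.
  apply: eq_integral => w _; apply/esym/cvg_lim => //.
  apply: cvg_EFin; first exact: nearW.
  apply: cvgM; last exact: cvg_cst.
  exact: hcvgR.
rewrite E monotone_convergence//.
apply: lime_le; last exact: nearW.
apply: ereal_nondecreasing_is_cvgn => n m nm.
by apply: ge0_le_integral => // w _; exact: hGnd.
Qed.

(** Independence is the case where every f i is an indicator.  The indicators are
    replaced by the functions f i one coordinate at a time: the induction bears on
    the number k of coordinates already replaced, for all choices of the remaining
    sets. *)
Lemma independent_prod_le (n : nat) (X : 'I_n -> {RV P >-> T'})
    (f : 'I_n -> T' -> R) :
  independent_RVs X -> (forall i, measurable_fun setT (f i)) ->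
  (forall i x, 0 <= f i x) ->
  (\int[P]_w (\prod_(i < n) f i (X i w))%:E <=
   \prod_(i < n) \int[P]_w (f i (X i w))%:E)%E.
Proof.
move=> indX mf f0.
pose g (k : nat) (A : 'I_n -> set T') (i : 'I_n) : T' -> R :=
  if (i < k)%N then f i else \1_(A i).
have g0 k A i x : 0 <= g k A i x by rewrite /g; case: ifP.
have mg k A i : (forall i, measurable (A i)) -> measurable_fun setT (g k A i).
  by move=> mA; rewrite /g; case: ifP => // _; exact: measurable_indic.
suff H k : (k <= n)%N -> forall A, (forall i, measurable (A i)) ->
    (\int[P]_w (\prod_(i < n) g k A i (X i w))%:E <=
     \prod_(i < n) \int[P]_w (g k A i (X i w))%:E)%E.
  have := H n (leqnn n) (fun=> setT) (fun=> measurableT).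
  by under eq_integral do under eq_bigr do rewrite /g ltn_ord;
    under [in leRHS]eq_bigr do under eq_integral do rewrite /g ltn_ord.
elim: k => [_|k IH kn] A mA.
  rewrite (eq_integral
    (fun w => (\1_(\bigcap_(i in [set: 'I_n]) (X i @^-1` A i)) w)%:E)).
    rewrite integral_indic//; last first.
      apply: fin_bigcap_measurable => // i _; exact: measurable_funPTI.
    rewrite setIT le_eqVlt; apply/orP; left; apply/eqP.
    apply: etrans (indX A mA) _; apply: eq_bigr => i _.
    rewrite -[RHS]/(\int[P]_w (\1_(X i @^-1` A i) w)%:E)%E.
    by rewrite integral_indic ?setIT//; exact: measurable_funPTI.
  move=> w _; congr EFin; rewrite indicE; case: (boolP (w \in _)).
    rewrite inE => wA; apply: big1 => i _.
    by rewrite /g /= indicE mem_set//; exact: wA.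
  rewrite notin_setE => wA.
  have [i wi] : exists i, ~ A i (X i w).
    by apply/not_existsP => h; apply: wA => i _; apply: contrapT; exact: h.
  by rewrite (bigD1 i)//= /g /= indicE memNset// mul0r.
pose j := Ordinal kn.
pose A' (B : set T') (i : 'I_n) := if i == j then B else A i.
have mA' B : measurable B -> forall i, measurable (A' B i).
  by move=> mB i; rewrite /A'; case: ifP.
have gE i B : i != j -> g k (A' B) i = g k.+1 A i.
  move=> ij; rewrite /g /A' (negbTE ij) ltnS [(i <= k)%N]leq_eqVlt.
  rewrite (_ : (i == k :> nat) = false)//.
  by apply: contra_neqF ij => /eqP ik; exact: val_inj.
pose G w := \prod_(i < n | i != j) g k.+1 A i (X i w).
have gj : g k.+1 A j = f j by rewrite /g /= ltnSn.
have gj' B : g k (A' B) j = \1_B by rewrite /g /A' /= ltnn eqxx.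
rewrite [leRHS](bigD1 j)//= gj.
under eq_integral do rewrite (bigD1 j)//= -/(G _) gj.
apply: (@le_integral_mul_of_indic (X j) G) => //.
- rewrite /G; under eq_fun do rewrite -big_filter.
  apply: measurable_prod => i _; apply: (measurableT_comp (mg k.+1 A i mA)).
  exact: measurable_funPT.
- by move=> w; apply: prodr_ge0 => i _.
- by apply: prode_ge0 => i _; apply: integral_ge0 => w _; rewrite lee_fin.
- move=> B mB; have := IH (ltnW kn) (A' B) (mA' B mB).
  rewrite [leRHS](bigD1 j)//= gj'.
  under [in leRHS]eq_bigr => i ij do rewrite gE//.
  under eq_integral => w _.
    rewrite (bigD1 j)//= gj'; under eq_bigr => i ij do rewrite gE//; over.
  by [].
Qed.

End independence.

(** * Growth of the moments of the product *)

Section growth.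
Context (R : realType).

(** Iterating the ratio bound from K on; M is chosen so large that the estimate
    holds up to K as well. *)
Lemma le_fact_sqr_of_ratio (b : nat -> R) (A : R) (K : nat) : 0 < A ->
    (forall k, 0 <= b k) ->
    (forall k, (K <= k)%N -> b k.+1 <= A * k.+1%:R ^+ 2 * b k) ->
  exists2 M, 0 <= M & forall k, b k <= M * (A ^+ k * k`!%:R ^+ 2).
Proof.
move=> A0 b0 bS; pose D k : R := A ^+ k * k`!%:R ^+ 2.
have D0 k : 0 < D k by rewrite mulr_gt0 ?exprn_gt0// ltr0n fact_gt0.
have q0 j : 0 <= b j / D j by rewrite divr_ge0// ltW.
pose M := \sum_(0 <= j < K.+1) b j / D j.
exists M => [|k]; first by apply: sumr_ge0 => j _.
rewrite -/(D k); have small j : (j <= K)%N -> b j <= M * D j.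
  move=> jK; rewrite -ler_pdivrMr// /M (bigD1_seq j) ?iota_uniq ?mem_index_iota//=.
  by rewrite lerDl sumr_ge0.
have [/small//|/ltnW Kk] := leqP k K.
rewrite -(subnK Kk); elim: (k - K)%N => [|j IH]; first by rewrite add0n small.
rewrite addSn; apply: (le_trans (bS _ (leq_addl _ _))).
rewrite [leRHS](_ : _ = A * (j + K).+1%:R ^+ 2 * (M * D (j + K)%N)).
  by apply: ler_wpM2l => //; rewrite mulr_ge0 ?(ltW A0)// sqr_ge0.
by rewrite /D factS natrM exprS; ring.
Qed.

Lemma prod_powR (n : nat) (a : R) (r : 'I_n -> R) : 0 < a ->
  \prod_(i < n) a `^ r i = a `^ (\sum_(i < n) r i).
Proof.
move=> a0; elim/big_rec2: _ => [|i x y _ ->]; first by rewrite powRr0.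
by rewrite powRD// (gt_eqF a0) implybT.
Qed.

End growth.

Section moments.
Context (R : realType) (d : measure_display) (T : measurableType d)
  (P : probability T R).

Lemma normr_moment (X : {RV P >-> R}) k : {ae P, forall w, 0 <= X w} ->
  (\int[P]_w (`|X w| ^+ k)%:E = moment P X k)%E.
Proof.
move=> X0; rewrite /moment unlock; apply: ae_eq_integral => //.
- apply/measurable_EFinP; apply: measurable_funX; exact: measurableT_comp.
- by apply/measurable_EFinP; apply: measurable_funX.
- by apply: filterS X0 => w w0 _; rewrite /= ger0_norm.
Qed.

Lemma moment_fineK (X : {RV P >-> R}) k : finite_moments P X ->
  (fine (moment P X k))%:E = moment P X k.
Proof. by move=> fX; rewrite fineK// /moment unlock integrable_fin_num. Qed.

Lemma fine_moment_ge0 (X : {RV P >-> R}) k : {ae P, forall w, 0 <= X w} ->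
  0 <= fine (moment P X k).
Proof.
by move=> X0; rewrite -normr_moment// fine_ge0// integral_ge0.
Qed.

(** A ratio bound says nothing when the denominator vanishes, since the quotient is
    then 0 by convention; but then X is almost surely 0. *)
Lemma fine_moment_eq0S (X : {RV P >-> R}) k : finite_moments P X ->
    {ae P, forall w, 0 <= X w} ->
  (0 < k)%N -> fine (moment P X k) = 0 -> fine (moment P X k.+1) = 0.
Proof.
move=> fX X0 k0 mk; have := moment_fineK k fX; rewrite mk -normr_moment// => /esym e.
have mX : measurable_fun setT (fun w => (`|X w| ^+ k)%:E).
  by apply/measurable_EFinP; apply: measurable_funX; exact: measurableT_comp.
have : (\int[P]_w `|(`|X w| ^+ k)%:E| = 0)%E.
  apply: etrans e; apply: eq_integral => w _; rewrite gee0_abs// lee_fin exprn_ge0.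
move/(ae_eq_integral_abs P measurableT mX) => ae0.
rewrite -normr_moment// (ae_eq_integral (cst 0%E)) ?integral0//.
  by apply/measurable_EFinP; apply: measurable_funX; exact: measurableT_comp.
apply: filterS ae0 => w /(_ I) [] /eqP; rewrite expf_eq0 k0 => /eqP Xw _.
by rewrite /= Xw expr0n.
Qed.

End moments.

Theorem theorem6 (R : realType) (d : measure_display) (T : measurableType d)
    (P : probability T R) (n : nat) (hn : (0 < n)%N)
    (xi : 'I_n -> {RV P >-> R}) (r : 'I_n -> R)
    (hindep : independent_RVs xi)
    (hnonneg : forall i, {ae P, forall w, 0 <= xi i w})
    (hmom : forall i, finite_moments P (xi i))
    (hgrowth : forall i,
      (fun k : nat => fine (moment P (xi i) k.+1) / fine (moment P (xi i) k))
        =O_\oo (fun k : nat => k.+1%:R `^ r i))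
    (hrates : \sum_(i < n) r i <= 2) :
  moment_determinate P (RV_prod xi).
Proof.
pose a i k := fine (moment P (xi i) k).
pose b k := \prod_(i < n) a i k.
have a0 i k : 0 <= a i k by exact: fine_moment_ge0.
have b0 k : 0 <= b k by apply: prodr_ge0 => i _.
have Zb k : (\int[P]_w (`|RV_prod xi w| ^+ k)%:E <= (b k)%:E)%E.
  have := @independent_prod_le R d _ T _ P n xi (fun=> fun x => `|x| ^+ k) hindep.
  rewrite /b -prodEFin => H.
  rewrite [leRHS](_ : _ = \prod_(i < n) \int[P]_w (`|xi i w| ^+ k)%:E)%E; last first.
    by apply: eq_bigr => i _; rewrite /a moment_fineK// normr_moment.
  rewrite (eq_integral (fun w => (\prod_(i < n) `|xi i w| ^+ k)%:E)).
    apply: H => [i|i x]; last by rewrite exprn_ge0.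
    by apply: measurable_funX; exact: normr_measurable.
  by move=> w _; rewrite /RV_prod normr_prod prodrXl.
have mZ : measurable_fun setT (RV_prod xi) by exact: measurable_funPT.
have iZ k : P.-integrable setT (fun w => (RV_prod xi w ^+ k)%:E).
  apply/integrableP; split.
    by apply/measurable_EFinP; apply: measurable_funX.
  under eq_integral do rewrite abse_EFin normrX.
  by apply: (le_lt_trans (Zb k)); rewrite ltry.
split; first exact: iZ.
(* In multiplied form the bound makes sense when the denominator vanishes. *)
have [c cP] : {c : 'I_n -> R & forall i, 0 < c i /\ \forall k \near \oo,
    a i k.+1 <= c i * k.+1%:R `^ r i * a i k}.
  apply: (choice (P := fun i c => 0 < c /\ \forall k \near \oo,
    a i k.+1 <= c * k.+1%:R `^ r i * a i k)) => i.
  have /eqO_exP[c c0 cP] := hgrowth i.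
  exists c; split=> //; near=> k.
  have k0 : (0 < k)%N by near: k; exact: nbhs_infty_gt.
  have : `|a i k.+1 / a i k| <= c * `|k.+1%:R `^ r i| by near: k.
  rewrite (ger0_norm (powR_ge0 _ _)) ger0_norm ?divr_ge0//.
  have [ak0 _|ak0] := eqVneq (a i k) 0.
    by rewrite [a i k.+1]fine_moment_eq0S// ak0 mulr0.
  by rewrite ler_pdivrMr// lt_def ak0 a0.
pose A := \prod_(i < n) c i.
have A0 : 0 < A by apply: prodr_gt0 => i _; exact: (cP i).1.
have [K _ KP] : \forall k \near \oo, forall i,
    a i k.+1 <= c i * k.+1%:R `^ r i * a i k.
  by apply: filter_forall => i; exact: (cP i).2.
have bS k : (K <= k)%N -> b k.+1 <= A * k.+1%:R ^+ 2 * b k.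
  move=> Kk; apply: (@le_trans _ _ (\prod_(i < n) (c i * k.+1%:R `^ r i * a i k))).
    by apply: ler_prod => i _; rewrite a0 KP.
  rewrite !big_split /= -/A -/(b k) prod_powR ?ltr0n//.
  apply: ler_wpM2r => //; apply: ler_wpM2l; first exact: ltW.
  rewrite -powR_mulrn ?ler0n//; apply: ler_powR => //.
  by rewrite ler1n.
have [M M0 MP] := le_fact_sqr_of_ratio A0 b0 bS.
move=> Q HQ B mB.
have mXk k : measurable_fun setT (fun x : R => (x ^+ k)%:E).
  by apply/measurable_EFinP; apply: measurable_funX.
pose nu := distribution P (RV_prod xi).
have nuE k : (\int[nu]_x (x ^+ k)%:E = \int[P]_w (RV_prod xi w ^+ k)%:E)%E.
  by rewrite integral_distribution//; exact: iZ.
apply: (@eq_probability_moments R Q nu M A M0 A0) => // [k|k|].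
- have inu : nu.-integrable setT (fun x : R => (x ^+ k)%:E).
    by apply: integrable_pushforward => //; exact: iZ.
  case: k inu => [|k] inu.
    have one (m : probability R R) : (\int[m]_x (x ^+ 0)%:E = 1)%E.
      rewrite (eq_integral (cst 1%E))// integral_cst// mul1e.
      exact: probability_setT.
    split; [exact: (finite_measure_integrable_cst Q (1 : R)) | exact: inu |].
    by rewrite one; apply/esym; exact: (one nu).
  have [iQ eQ] := HQ k.+1 isT; split => //.
  by rewrite eQ nuE /moment unlock.
- rewrite nuE; apply: (@le_trans _ _ (b k)%:E); last by rewrite lee_fin.
  apply: le_trans (Zb k); apply: (le_trans (lee_abs _)).
  apply: (le_trans (le_abse_integral _ _ _)) => //.
    exact: (measurable_int P (iZ k)).
  by under eq_integral do rewrite abse_EFin normrX.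
- have Z0 : {ae P, forall w, 0 <= RV_prod xi w}.
    have : \forall w \ae P, forall i, 0 <= xi i w by exact: filter_forall.
    by apply: filterS => w w0; apply: prodr_ge0 => i _.
  have mN : measurable [set x : R | 0 <= x].
    rewrite (_ : [set x | _] = `[0, +oo[%classic)//.
    by apply/seteqP; split => x /=; rewrite in_itv/= andbT.
  have mNC : measurable (~` [set x : R | 0 <= x]) by exact: measurableC.
  apply/(negligibleP _ mNC).
  apply/(negligibleP P (measurable_funPTI (RV_prod xi) mNC)).
  exact: Z0.
Unshelve. all: end_near. Qed.
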